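(* Let $X$ be a finite graph in which every vertex has positive degree, with a (Hermitian) symmetric transmission system $P$ with ranks $n(v)$. Let $\Psi:V(X)\to V'$ be a surjection such that $n(v)=n(w)$ whenever $\Psi(v)=\Psi(w)$, and let $X'$ be the collapsed graph with the induced transmission system. Then the induced transmission system on $X'$ is (Hermitian) symmetric, and if $\lambda_1\le\lambda_2\le\cdots$ are the eigenvalues of $\Delta^P$ on $X$ and $\mu_1\le\mu_2\le\cdots$ those of the transmission graph Laplacian on $X'$ (both counted with multiplicity), then $\lambda_j\le\mu_j$ for every $j$ for which $\mu_j$ is defined.
   Context: Graph conventions: $V(X)$ vertex set; each undirected edge gives two directed edges (a loop gives two directed loops); $E^+(X)$ directed edges; $i(\vec e),t(\vec e)$ initial/terminal points; $op(\vec e)$ reversed edge; degree $d_w=\#\{\vec e: t(\vec e)=w\}$. A transmission system $P$ assigns to each vertex $v$ an integer $n(v)\ge0$ and to each directed edge $\vec e$ a complex $n(t(\vec e))\times n(i(\vec e))$ matrix $P(\vec e)$; it is (Hermitian) symmetric if $P(op(\vec e))=P(\vec e)^\star$. Cochains $C^0=\bigoplus_v\mathbb{C}^{n(v)}$ with inner product $\sum_v\langle f(v),g(v)\rangle$; transmission graph Laplacian $(\Delta^P f)(w)=f(w)-\sum_{\vec e: t(\vec e)=w}(d_w d_{i(\vec e)})^{-1/2}P(\vec e)f(i(\vec e))$. Collapse: $X'$ has vertex set $V'$ with rank $n'(\Psi(v))=n(v)$, and exactly the same set of directed edges $E^+(X)$, with the same opposite-edge pairing, where $\vec e$ is regarded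 as having initial point $\Psi(i(\vec e))$ and terminal point $\Psi(t(\vec e))$; the induced transmission system assigns to $\vec e$ the same matrix $P(\vec e)$. (Thus the degree of $p\in V'$ in $X'$ is $\sum_{w:\Psi(w)=p}d_w$.) *)

(* Defs.v *)
From HB Require Import structures.
From mathcomp Require Import all_boot all_order all_algebra.
From mathcomp Require Import reals.
From mathcomp.real_closed Require Import complex.

Set Implicit Arguments.
Unset Strict Implicit.
Unset Printing Implicit Defensive.

Import Order.TTheory GRing.Theory Num.Theory.
Local Open Scope ring_scope.
Local Open Scope complex_scope.
Local Open Scope sesquilinear_scope.

(* [edge X] is the type of directed edges; an undirected edge is a pair
   {e, op e}. As [op] has no fixed point, a loop gives two directed loops.
   Loops and multiple edges are allowed. *)
Record graph := Graph {
  vert :> finType;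
  edge : finType;
  ini : edge -> vert;
  ter : edge -> vert;
  op : edge -> edge;
  opK : involutive op;
  op_neq : forall e, op e != e;
  ini_op : forall e, ini (op e) = ter e
}.

Arguments ini {g}.
Arguments ter {g}.
Arguments op {g}.

Lemma ter_op (X : graph) (e : edge X) : ter (op e) = ini e.
Proof. by rewrite -ini_op opK. Qed.

Definition deg (X : graph) (w : X) : nat := #|[pred e : edge X | ter e == w]|.

Record transmission (R : realType) (X : graph) := Transmission {
  rank : X -> nat;
  tmx :> forall e : edge X, 'M[R[i]]_(rank (ter e), rank (ini e))
}.

(* [castmx] only transports along [ini e = ter (op e)], [ter e = ini (op e)]. *)
Definition tsymmetric (R : realType) (X : graph) (P : transmission R X) :=
  forall e : edge X,
    P (op e) = castmx (congr1 (rank P) (esym (ter_op e)),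
                       congr1 (rank P) (esym (ini_op e))) ((P e)^t*).

Section Cochains.
Variables (R : realType) (X : graph) (P : transmission R X).

(* The direct sum over [v] of the spaces 'cV_(rank P v), as the functions on
   the disjoint union of the index sets; [cochain_val] and [cochain_of] are
   inverse to each other. *)
Definition cochain := {ffun {v : X & 'I_(rank P v)} -> R[i]^o}.

Definition cochain_val (f : cochain) (v : X) : 'cV[R[i]]_(rank P v) :=
  \col_i f (Tagged (fun v => 'I_(rank P v)) i).

Definition cochain_of (F : forall v : X, 'cV[R[i]]_(rank P v)) : cochain :=
  [ffun u => F (tag u) (tagged u) 0].

Lemma cochain_valK (f : cochain) : cochain_of (cochain_val f) = f.
Proof. by apply/ffunP => -[v i]; rewrite !ffunE mxE. Qed.

Lemma cochain_ofK F v : cochain_val (cochain_of F) v = F v.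
Proof. by apply/colP => i; rewrite !mxE ffunE. Qed.

Lemma cochain_valP (a : R[i]) (f g : cochain) (v : X) :
  cochain_val (a *: f + g) v = a *: cochain_val f v + cochain_val g v.
Proof. by apply/colP => i; rewrite !mxE !ffunE. Qed.

End Cochains.

(* The vector [P e *m _] has height [rank P (ter e)]; since the sum is
   restricted to [ter e = w], [conform_mx] here is just the transport of that
   vector to 'cV_(rank P w), and its default value 0 is never used.
   Locked: unification of [laplacian f] with [laplacian g] would otherwise
   unfold both sides and blow up. *)
HB.lock Definition laplacian (R : realType) (X : graph) (P : transmission R X)
    (f : cochain P) : cochain P :=
  cochain_of (fun w =>
    cochain_val f w -
    \sum_(e : edge X | ter e == w)
      ((Num.sqrt (deg w * deg (ini e))%:R)^-1)%:C *:
        conform_mx 0 (P e *m cochain_val f (ini e))).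

Section Laplacian.
Variables (R : realType) (X : graph) (P : transmission R X).

Lemma laplacian_val (f : cochain P) (w : X) :
  cochain_val (laplacian f) w =
    cochain_val f w -
    \sum_(e : edge X | ter e == w)
      ((Num.sqrt (deg w * deg (ini e))%:R)^-1)%:C *:
        conform_mx 0 (P e *m cochain_val f (ini e)).
Proof. by rewrite laplacian.unlock cochain_ofK. Qed.

Lemma laplacian_is_linear : linear (@laplacian R X P).
Proof.
move=> a f g; rewrite -[LHS]cochain_valK -[RHS]cochain_valK.
apply/ffunP => -[w i]; rewrite [LHS]ffunE [RHS]ffunE.
congr (fun_of_matrix _ _ _) => /=.
rewrite (cochain_valP a (laplacian f)) !laplacian_val (cochain_valP a f g w).
rewrite scalerBr addrACA -opprD; congr (_ - _).
rewrite scaler_sumr -big_split; apply: eq_bigr => e /eqP ew /=.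
case: w / ew {i}; rewrite !conform_mx_id (cochain_valP a f g (ini e)).
by rewrite mulmxDr -scalemxAr scalerDr !scalerA mulrC.
Qed.

HB.instance Definition _ :=
  GRing.isLinear.Build R[i] (cochain P) (cochain P) _
    (@laplacian R X P) laplacian_is_linear.

Definition Delta : 'End(cochain P) := linfun (@laplacian R X P).

Lemma DeltaE f : Delta f = laplacian f.
Proof. exact: lfunE. Qed.

End Laplacian.

(* [s] lists in nondecreasing order the eigenvalues of [phi], each repeated
   according to the dimension of its eigenspace. As [a] ranges over all complex
   numbers, this includes that every eigenvalue is real; such an [s] is
   unique. *)
Definition is_spectrum (R : realType) (V : vectType R[i]) (phi : 'End(V))
    (s : seq R) : Prop :=
  sorted <=%R s /\
  forall a : R[i],
    count_mem a [seq x%:C | x <- s] = \dim (passmx.leigenspace phi a).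

Section Collapse.
Variables (R : realType) (X : graph) (P : transmission R X).
Variables (V' : finType) (Psi : X -> V').

Lemma collapse_ini_op (e : edge X) : Psi (ini (op e)) = Psi (ter e).
Proof. by rewrite ini_op. Qed.

Definition collapse : graph :=
  @Graph V' (edge X) (fun e => Psi (ini e)) (fun e => Psi (ter e))
         op (@opK X) (@op_neq X) collapse_ini_op.

Lemma deg_collapse (p : V') :
  deg (p : collapse) = (\sum_(w : X | Psi w == p) deg w)%N.
Proof.
rewrite /deg -sum1_card (partition_big (@ter X) (fun w => Psi w == p)) //=.
apply: eq_bigr => w /eqP <-; rewrite -sum1_card; apply: eq_bigl => e.
by rewrite !inE; case: (ter e =P w) => [->|_]; rewrite ?eqxx ?andbF.
Qed.

(* The value 0 is only used outside the image of [Psi]. *)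
Definition collapse_rank (p : V') : nat :=
  if [pick v | Psi v == p] is Some v then rank P v else 0%N.

Hypothesis rank_fibre : forall v w, Psi v = Psi w -> rank P v = rank P w.

Lemma collapse_rankE v : rank P v = collapse_rank (Psi v).
Proof.
rewrite /collapse_rank; case: pickP => [w /eqP /rank_fibre -> //|].
by move/(_ v); rewrite eqxx.
Qed.

Definition collapse_transmission : transmission R collapse :=
  @Transmission R collapse collapse_rank
    (fun e : edge X =>
       castmx (collapse_rankE (ter e), collapse_rankE (ini e)) (P e)).

End Collapse.

(* Main.v *)
Require Import Defs.
From HB Require Import structures.
From mathcomp Require Import all_boot all_order all_algebra perm.
From mathcomp Require Import reals ring.
From mathcomp.real_closed Require Import complex.

(** The pullback (J f)(v) = sqrt(d_v / d'_(Psi v)) f(Psi v) is an isometry from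
    the cochains of the collapsed graph to those of X, because the degrees in a
    fibre of Psi add up to the degree of its image. The square roots are such
    that the edge weights match: <Delta J f, J f> = <Delta' f, f>. So Delta' is
    the compression of Delta along J, and Cauchy interlacing applies. *)

Set Implicit Arguments.
Unset Strict Implicit.
Unset Printing Implicit Defensive.

Import Order.TTheory GRing.Theory Num.Theory.
(* Opened before [ring_scope], so that [^*] is [Num.conj], as in [^t*]. *)
Local Open Scope complex_scope.
Local Open Scope ring_scope.
Local Open Scope sesquilinear_scope.

(** * Hermitian inner product and orthonormal families on functions over a finite set *)

Section InnerProduct.
Variables (C : numClosedFieldType) (T : finType).
Local Notation V := {ffun T -> C^o}.

Definition fdot (f g : V) : C := \sum_t f t * (g t)^*.

Lemma fdotDl f g h : fdot (f + g) h = fdot f h + fdot g h.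
Proof. by rewrite -big_split; apply: eq_bigr => t _; rewrite ffunE mulrDl. Qed.

Lemma fdotZl a f g : fdot (a *: f) g = a * fdot f g.
Proof. by rewrite mulr_sumr; apply: eq_bigr => t _; rewrite ffunE mulrA. Qed.

Lemma fdotC f g : fdot g f = (fdot f g)^*.
Proof.
by rewrite rmorph_sum; apply: eq_bigr => t _; rewrite rmorphM /= conjCK mulrC.
Qed.

Lemma fdotZr a f g : fdot f (a *: g) = a^* * fdot f g.
Proof. by rewrite fdotC fdotZl rmorphM /= -fdotC. Qed.

Lemma fdot_suml I (r : seq I) (c : I -> C) (w : I -> V) g :
  fdot (\sum_(i <- r) c i *: w i) g = \sum_(i <- r) c i * fdot (w i) g.
Proof.
elim: r => [|i r IH]; last by rewrite !big_cons fdotDl fdotZl IH.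
by rewrite !big_nil /fdot big1 // => t _; rewrite ffunE mul0r.
Qed.

Lemma fdot_sumr I (r : seq I) (c : I -> C) (w : I -> V) g :
  fdot g (\sum_(i <- r) c i *: w i) = \sum_(i <- r) (c i)^* * fdot g (w i).
Proof.
rewrite fdotC fdot_suml rmorph_sum; apply: eq_bigr => i _.
by rewrite rmorphM /= -fdotC.
Qed.

Definition orthonormal (I : eqType) (b : I -> V) :=
  forall i j, fdot (b i) (b j) = (i == j)%:R.

Lemma orthonormal_sum (I : finType) (b : I -> V) (c d : I -> C) :
  orthonormal b ->
  fdot (\sum_i c i *: b i) (\sum_i d i *: b i) = \sum_i c i * (d i)^*.
Proof.
move=> ob; rewrite fdot_suml; apply: eq_bigr => i _; congr (_ * _).
rewrite fdot_sumr (bigD1 i) //= ob eqxx mulr1 big1 ?addr0 // => j /negPf ji.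
by rewrite ob eq_sym ji mulr0.
Qed.

(** The values of [b] form a square matrix [B] with orthonormal rows. Being square, it has [B^t*] as
    a left inverse too, and that product is the completeness relation. *)
Lemma orthonormal_expand (b : 'I_#|T| -> V) (f : V) :
  orthonormal b -> f = \sum_i fdot f (b i) *: b i.
Proof.
move=> ob; pose B : 'M[C]_#|T| := \matrix_(i, k) b i (enum_val k).
have BK : B^t* *m B = 1%:M.
  apply: mulmx1C; apply/matrixP => i j; rewrite !mxE -ob /fdot.
  rewrite [RHS](reindex _ (onW_bij _ (enum_val_bij T))) /=.
  by apply: eq_bigr => k _; rewrite !mxE.
apply/ffunP => t.
transitivity (\sum_k f (enum_val k) * (B^t* *m B) k (enum_rank t)).
  rewrite BK (bigD1 (enum_rank t)) //= !mxE eqxx mulr1 enum_rankK.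
  by rewrite big1 ?addr0 // => k /negPf kt; rewrite mxE kt mulr0.
under eq_bigr do rewrite mxE mulr_sumr.
rewrite exchange_big sum_ffunE; apply: eq_bigr => i _; rewrite ffunE.
transitivity (fdot f (b i) * b i t); last by [].
rewrite mulr_suml.
rewrite [RHS](reindex _ (onW_bij _ (enum_val_bij T))) /=.
by apply: eq_bigr => k _; rewrite !mxE enum_rankK mulrA.
Qed.

Lemma parseval (b : 'I_#|T| -> V) f g :
  orthonormal b -> fdot f g = \sum_i fdot f (b i) * (fdot g (b i))^*.
Proof. by move=> ob; rewrite -(orthonormal_sum _ _ ob) -!orthonormal_expand. Qed.

Lemma orthonormal_free (b : 'I_#|T| -> V) :
  orthonormal b -> free [tuple b i | i < #|T|].
Proof.
move=> ob; apply/freeP => c c0 i.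
have /(congr1 (fdot^~ (b i))) := c0.
under eq_bigr do rewrite -tnth_nth tnth_mktuple.
rewrite fdot_suml (bigD1 i) //= ob eqxx mulr1 big1 ?addr0 => [->|j /negPf ji].
  by rewrite /fdot big1 // => t _; rewrite ffunE mul0r.
by rewrite ob ji mulr0.
Qed.

(** There are fewer conditions than coefficients, so the matrix of inner products has a nonzero left
    kernel. *)
Lemma exists_orthogonal_comb m n (w : 'I_m -> V) (b : 'I_n -> V) :
  (n < m)%N -> exists2 c : 'I_m -> C,
    exists k, c k != 0 & forall i, fdot (\sum_k c k *: w k) (b i) = 0.
Proof.
move=> nm; pose A : 'M[C]_(m, n) := \matrix_(k, i) fdot (w k) (b i).
have : kermx A != 0.
  by rewrite kermx_eq0 -row_leq_rank -ltnNge (leq_ltn_trans (rank_leq_col A)).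
case/rowV0Pn => c /sub_kermxP cA c0; exists (c 0).
  by apply/existsP; move: c0; apply: contraNT => /existsPn c0;
    apply/eqP/rowP => k; rewrite mxE; apply/eqP; rewrite -[_ == _]negbK c0.
move=> i; have /rowP/(_ i) := cA; rewrite !mxE => <-.
by rewrite fdot_suml; apply: eq_bigr => k _; rewrite mxE.
Qed.

(** * Spectral theorem for self-adjoint endomorphisms *)

Definition self_adjoint (phi : 'End(V)) :=
  forall f g, fdot (phi f) g = fdot f (phi g).

Variable phi : 'End(V).
Hypothesis phi_sa : self_adjoint phi.

Definition eigenbasis (x : 'I_#|T| -> C) (b : 'I_#|T| -> V) :=
  orthonormal b /\ forall i, phi (b i) = x i *: b i.

(** In the standard basis [d] self-adjointness makes the matrix of [phi] Hermitian, hence unitarily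
    diagonalizable with real diagonal. *)
Lemma exists_eigenbasis :
  exists x b, (forall i, x i \is Num.real) /\ eigenbasis x b.
Proof.
pose d (k : 'I_#|T|) : V := [ffun t => (t == enum_val k)%:R].
(* Row [k] holds the coordinates of [phi (d k)]: [phi] acts on row vectors from the right, so the
   eigenvectors are the rows of [U]. *)
pose A : 'M[C]_#|T| := \matrix_(k, l) phi (d k) (enum_val l).
have dE f k : fdot f (d k) = f (enum_val k).
  rewrite /fdot (bigD1 (enum_val k)) //= ffunE eqxx conjC1 mulr1.
  by rewrite big1 ?addr0 // => t /negPf tk; rewrite ffunE tk conjC0 mulr0.
have fE (f : V) : f = \sum_k f (enum_val k) *: d k.
  apply/ffunP => t; rewrite sum_ffunE (bigD1 (enum_rank t)) //= !ffunE.
  rewrite enum_rankK eqxx [_ *: _]mulr1 big1 ?addr0 // => k kt.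
  rewrite !ffunE; case: eqP => [tk|_]; last by rewrite scaler0.
  by rewrite tk enum_valK eqxx in kt.
have hA : A \is hermsymmx.
  apply/is_hermitianmxP; rewrite expr0 scale1r; apply/matrixP => k l.
  by rewrite !mxE -!dE phi_sa [LHS]fdotC.
have := hermitian_normalmx hA => /orthomx_spectralP AE.
have /mxOverP dr := hermitian_spectral_diag_real hA.
set U := spectralmx A in AE; set D := spectral_diag A in AE dr.
have UU := spectral_unitarymx A; rewrite -/U in UU.
pose b i : V := [ffun t => U i (enum_rank t)].
exists (D 0), b; split=> [//|]; split=> [i j|i].
  have /unitarymxP/matrixP/(_ i j) := UU; rewrite !mxE => <-.
  rewrite /fdot (reindex _ (onW_bij _ (enum_val_bij T))) /=.
  by apply: eq_bigr => k _; rewrite !mxE !ffunE enum_valK.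
have UA : U *m A = diag_mx D *m U.
  by rewrite {1}AE -mulmxA mulKVmx // unitarymx_unit.
apply/ffunP => t; rewrite {1}[b i]fE linear_sum sum_ffunE ffunE.
have /matrixP/(_ i (enum_rank t)) := UA.
rewrite mul_diag_mx !mxE ffunE => UAi; rewrite [RHS](esym UAi).
apply: eq_bigr => k _.
by rewrite linearZ !ffunE mxE enum_valK enum_rankK.
Qed.

(** The members of [b] with eigenvalue [a] are free and span the eigenspace, so counting them gives
    its dimension. *)
Lemma dim_leigenspace x b a : (forall i, x i \is Num.real) -> eigenbasis x b ->
  \dim (passmx.leigenspace phi a) = count_mem a [seq x i | i : 'I_#|T|].
Proof.
move=> xr [ob bE]; set E := passmx.leigenspace phi a.
have EP v : (v \in E) = (phi v == a *: v).
  by rewrite memv_ker add_lfunE opp_lfunE scale_lfunE id_lfunE subr_eq0.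
have b0 i : b i != 0.
  apply/eqP => bi0; have := ob i i; rewrite bi0 eqxx /fdot big1 => [/esym/eqP|].
    by rewrite oner_eq0.
  by move=> t _; rewrite ffunE mul0r.
have bEP i : (b i \in E) = (x i == a).
  by rewrite EP bE -subr_eq0 -scalerBl scaler_eq0 (negPf (b0 i)) orbF subr_eq0.
pose X := [tuple b i | i < #|T|]; pose Y := filter (mem E) X.
have /eqP fY : free Y by exact/filter_free/orthonormal_free.
have -> : E = <<Y>>%VS.
  apply/eqP; rewrite eqEsubv; apply/andP; split; last first.
    by apply/span_subvP => v; rewrite mem_filter => /andP[].
  apply/subvP => v vE; rewrite (orthonormal_expand v ob).
  apply: rpred_sum => i _; case: (eqVneq (x i) a) => [xia|xia].
    apply/rpredZ/memv_span; rewrite mem_filter /= bEP xia eqxx.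
    by apply/mapP; exists i; rewrite ?mem_enum.
  (* Moving [phi] across the product gives [a * fdot v (b i) = x i * fdot v (b i)], as [x i] is
     real; here [x i] differs from [a]. *)
  suff -> : fdot v (b i) = 0 by rewrite scale0r rpred0.
  have := phi_sa v (b i); rewrite bE fdotZr (CrealP (xr i)).
  move: vE; rewrite EP => /eqP ->; rewrite fdotZl => /eqP.
  by rewrite -subr_eq0 -mulrBl mulf_eq0 subr_eq0 eq_sym (negPf xia) => /eqP.
rewrite fY size_filter /= !count_map; apply: eq_count => i /=.
by rewrite bEP.
Qed.

Lemma eigenbasis_form x b f : (forall i, x i \is Num.real) -> eigenbasis x b ->
  fdot (phi f) f = \sum_i x i * `|fdot f (b i)| ^+ 2.
Proof.
move=> xr [ob bE].
rewrite (parseval _ _ ob); apply: eq_bigr => i _.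
by rewrite phi_sa bE fdotZr (CrealP (xr i)) normCK mulrA.
Qed.

End InnerProduct.

(** * Sorted real spectra and Cauchy interlacing *)

Section Spectrum.
Variables (R : realType).

Lemma real_complex_real (x : R) : x%:C \is Num.real.
Proof. exact/CrealP/conjc_real. Qed.

Lemma is_spectrumP (T : finType) (phi : 'End({ffun T -> R[i]^o}))
    (x : 'I_#|T| -> R) b (s : seq R) :
  self_adjoint phi ->
  eigenbasis phi (fun i => (x i)%:C) b ->
  is_spectrum phi s <-> sorted <=%R s /\ perm_eq s [tuple x i | i < #|T|].
Proof.
move=> sa xb; have xr i : (x i)%:C \is Num.real by exact: real_complex_real.
have dimE a := dim_leigenspace sa a xr xb.
split=> -[ss sE]; split=> //.
  (* Multiplicities are known for complex numbers, so the lists are compared there and pulled back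
     along the injection of [R]. *)
  apply: (perm_map_inj (@complexI R)); apply/allP => a _ /=.
  by rewrite sE dimE -map_comp.
by move=> a; rewrite dimE (seq.permP (perm_map _ sE)) /= -map_comp.
Qed.

Lemma exists_real_eigenbasis (T : finType) (phi : 'End({ffun T -> R[i]^o})) :
  self_adjoint phi ->
  exists (x : 'I_#|T| -> R) b, eigenbasis phi (fun i => (x i)%:C) b.
Proof.
move=> /exists_eigenbasis [x [b [xr [ob bE]]]].
exists (fun i => complex.Re (x i)), b.
by split=> // i; rewrite RRe_real.
Qed.

Lemma exists_spectrum (T : finType) (phi : 'End({ffun T -> R[i]^o})) :
  self_adjoint phi -> exists s : seq R, is_spectrum phi s.
Proof.
move=> sa; have [x [b xb]] := exists_real_eigenbasis sa.
exists (sort <=%R [tuple x i | i < #|T|]); apply/(is_spectrumP _ sa xb).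
by split; [exact: sort_le_sorted | rewrite perm_sort].
Qed.

(** Any eigenbasis has the entries of [s] as eigenvalues up to a permutation; permuting the vectors
    likewise aligns them with [s]. *)
Lemma spectrum_eigenbasis (T : finType) (phi : 'End({ffun T -> R[i]^o})) s :
  self_adjoint phi -> is_spectrum phi s ->
  size s = #|T| /\ exists b, eigenbasis phi (fun i => (s`_i)%:C) b.
Proof.
move=> sa ss; have [x [b xb]] := exists_real_eigenbasis sa.
have /(is_spectrumP _ sa xb)[_ /tuple_permP[p sE]] := ss.
split; first by rewrite sE size_tuple.
have [ob bE] := xb.
exists (b \o p); split=> [i j|i]; first by rewrite /= ob (inj_eq perm_inj).
by rewrite /= bE sE -tnth_nth !tnth_mktuple.
Qed.

(* Cauchy interlacing: as j < j+1, some u <> 0 in the span of the first j+1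
   eigenvectors of psi has J u orthogonal to the first j eigenvectors of phi;
   compare the values of the two quadratic forms at u. *)
Lemma interlacing (T T' : finType) (phi : 'End({ffun T -> R[i]^o}))
    (psi : 'End({ffun T' -> R[i]^o}))
    (J : {linear {ffun T' -> R[i]^o} -> {ffun T -> R[i]^o}}) s r :
  self_adjoint phi ->
  self_adjoint psi ->
  (forall u, fdot (J u) (J u) = fdot u u) ->
  (forall u, fdot (phi (J u)) (J u) = fdot (psi u) u) ->
  is_spectrum phi s -> is_spectrum psi r ->
  forall j, (j < size r)%N -> (j < size s)%N /\ s`_j <= r`_j.
Proof.
move=> sa sa' Jiso Jform ss sr j jr.
have [size_s [b [ob bE]]] := spectrum_eigenbasis sa ss.
have [size_r [d [od dE]]] := spectrum_eigenbasis sa' sr.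
have jT : (j < #|T'|)%N by rewrite -size_r.
pose w := d \o widen_ord jT.
have ow : orthonormal w by move=> k l; rewrite /w /= od.
have Jsum (c : 'I_j.+1 -> R[i]) : J (\sum_k c k *: w k) = \sum_k c k *: J (w k).
  by rewrite linear_sum; apply: eq_bigr => k _; rewrite linearZ.
(* Used for two values of [n]. With [n = #|T|], [J u] would be orthogonal to a whole basis, against
   isometry, which forces [j < size s]; [n = j] gives the inequality. *)
have witness (n : nat) (le_n : (n <= #|T|)%N) : (n < j.+1)%N ->
    exists2 u, 0 < fdot u u & (fdot (psi u) u <= (r`_j)%:C * fdot u u) /\
      forall i : 'I_n, fdot (J u) (b (widen_ord le_n i)) = 0.
  move=> /(exists_orthogonal_comb (J \o w) (b \o widen_ord le_n)).
  move=> [c [k ck] cb]; exists (\sum_k c k *: w k).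
    rewrite (orthonormal_sum _ _ ow) (bigD1 k) //= ltr_pwDl //.
      by rewrite -normCK exprn_gt0 // normr_gt0.
    by apply: sumr_ge0 => l _; exact: mul_conjC_ge0.
  split; last by move=> i; rewrite Jsum cb.
  rewrite linear_sum /=.
  under eq_bigr => l _ do rewrite linearZ /= /w /= dE scalerA.
  rewrite !(orthonormal_sum _ _ ow) mulr_sumr; apply: ler_sum => l _.
  rewrite mulrAC mulrC ler_wpM2r ?mul_conjC_ge0 //.
  (* [u] involves only the eigenvalues of [psi] up to index [j], the largest of which is the
     last. *)
  have lj : (l <= j)%N by rewrite -ltnS.
  rewrite lecR; apply: (le_sorted_leq_nth 0 (proj1 sr)) => //.
  by rewrite inE (leq_ltn_trans lj).
have js : (j < size s)%N.
  rewrite ltnNge size_s; apply/negP => Tj.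
  have [u u0 [_ uT]] := witness _ (leqnn _) Tj.
  suff : fdot (J u) (J u) = 0 by rewrite Jiso => uu; rewrite uu ltxx in u0.
  rewrite (parseval _ _ ob) big1 // => i _.
  have := uT i; rewrite (_ : widen_ord _ i = i); last exact: val_inj.
  by move=> ->; rewrite mul0r.
split=> //; have jTs : (j < #|T|)%N by rewrite -size_s.
have [u u0 [uj uT]] := witness j (ltnW jTs) (ltnSn j).
rewrite -lecR -(ler_pM2r u0); apply: le_trans uj.
have sr_real i := real_complex_real s`_i.
rewrite -Jform -Jiso (eigenbasis_form sa _ (fun i => sr_real _) (conj ob bE)) //.
rewrite (parseval _ _ ob) mulr_sumr; apply: ler_sum => i _.
(* Coefficients of index below [j] vanish by the choice of [u]; the others carry eigenvalues at
   least the one of index [j]. *)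
rewrite -normCK; case: (ltnP i j) => [ij|ji].
  have := uT (Ordinal ij); rewrite (_ : widen_ord _ _ = i); last exact: val_inj.
  by move=> ->; rewrite normr0 expr0n !mulr0.
rewrite ler_wpM2r ?exprn_ge0 // lecR.
by apply: (le_sorted_leq_nth 0 (proj1 ss)) => //; rewrite inE size_s.
Qed.

End Spectrum.

(** * The sesquilinear form of the Laplacian *)

Section LaplacianForm.
Variables (R : realType) (X : graph) (P : transmission R X).
Implicit Types f g : cochain P.

Lemma fdot_cochain f g :
  fdot f g = \sum_v ((cochain_val g v)^t* *m cochain_val f v) 0 0.
Proof.
pose F v (i : 'I_(rank P v)) : R[i] :=
  f (Tagged (fun v => 'I_(rank P v)) i) *
  (g (Tagged (fun v => 'I_(rank P v)) i))^*.
transitivity (\sum_v \sum_i F v i).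
  rewrite (sig_big_dep xpredT (fun _ => xpredT) F).
  by apply: eq_bigr => -[v i].
apply: eq_bigr => v _; rewrite mxE; apply: eq_bigr => i _.
by rewrite !mxE mulrC.
Qed.

Definition edge_weight (e : edge X) : R :=
  (Num.sqrt (deg (ter e) * deg (ini e))%:R)^-1.

(** Grouping directed edges by terminal vertex yields one sum over all edges. Since collapsing keeps
    the edges, the forms of both graphs can be compared edge by edge. *)
Lemma laplacian_form f g :
  fdot (laplacian f) g = fdot f g - \sum_(e : edge X) (edge_weight e)%:C *
    ((cochain_val g (ter e))^t* *m P e *m cochain_val f (ini e)) 0 0.
Proof.
rewrite !fdot_cochain (partition_big (@ter X) xpredT) //= -sumrB.
apply: eq_bigr => w _; rewrite laplacian_val mulmxBr.
rewrite [LHS]mxE [X in _ + X = _]mxE; congr (_ - _).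
rewrite mulmx_sumr summxE; apply: eq_bigr => e /eqP ew.
case: w / ew; rewrite conform_mx_id -scalemxAr mulmxA mxE.
by [].
Qed.

Lemma tsymmetric_form f g (e : edge X) : tsymmetric P ->
  ((cochain_val g (ter (op e)))^t* *m P (op e) *m cochain_val f (ini (op e))) 0 0
  = (((cochain_val f (ter e))^t* *m P e *m cochain_val g (ini e)) 0 0)^*.
Proof.
move=> ->.
(* Generic endpoints allow the equalities to be eliminated, which is impossible for [ter (op e)] and
   [ini (op e)]. *)
have castE v v' w w' (Ev : v = v') (Ew : w = w') (M : 'M_(rank P v, rank P w)) :
  (cochain_val g v')^t* *m castmx (congr1 (rank P) Ev, congr1 (rank P) Ew) M
    *m cochain_val f w' = (cochain_val g v)^t* *m M *m cochain_val f w.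
  by case: v' / Ev; case: w' / Ew; rewrite castmx_id.
rewrite castE.
rewrite [X in X^*](_ : _ = (((cochain_val g (ini e))^t* *m (P e)^t* *m
  cochain_val f (ter e))^t*) 0 0); first by rewrite !mxE conjCK.
by rewrite !trmx_mul !map_mxM !trmxCK mulmxA.
Qed.

(** Reversal permutes the directed edges, keeps the real weights, and turns each edge term into the
    conjugate of the one with [f] and [g] swapped. *)
Lemma Delta_self_adjoint : tsymmetric P -> self_adjoint (Delta P).
Proof.
move=> symP f g; rewrite [RHS]fdotC !DeltaE !laplacian_form rmorphB /= -fdotC.
congr (_ - _); rewrite rmorph_sum (reindex_inj (inv_inj (@opK X))) /=.
apply: eq_bigr => e _; rewrite tsymmetric_form // rmorphM /=.
rewrite (CrealP (real_complex_real _)).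
by rewrite /edge_weight ter_op ini_op mulnC.
Qed.

End LaplacianForm.

Arguments edge_weight {R X} e.

(** * Pullback of cochains along the collapse *)

Lemma conjmx_scale_real (R : realType) m (x : R) (u : 'cV[R[i]]_m) :
  (x%:C *: u)^t* = x%:C *: u^t*.
Proof. by rewrite linearZ map_mxZ /= (CrealP (real_complex_real x)). Qed.

Lemma cast_form (C : numClosedFieldType) m n m' n' (Em : m = m') (En : n = n')
    (M : 'M[C]_(m, n)) u v :
  (castmx (esym Em, erefl 1%N) u)^t* *m M *m castmx (esym En, erefl 1%N) v =
  u^t* *m castmx (Em, En) M *m v.
Proof. by case: m' / Em u; case: n' / En v => v u; rewrite !castmx_id. Qed.

Section CollapseForm.
Variables (R : realType) (X : graph) (P : transmission R X).
Variables (V' : finType) (Psi : X -> V').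
Hypothesis rank_fibre : forall v w, Psi v = Psi w -> rank P v = rank P w.
Local Notation P' := (collapse_transmission rank_fibre).
Local Notation rankE := (collapse_rankE rank_fibre).

(** Both sides are transports of [(P e)^t*] to the same dimensions, and transport does not depend on
    the equality proofs. *)
Lemma collapse_tsymmetric : tsymmetric P -> tsymmetric P'.
Proof.
move=> symP e; rewrite /= symP trmx_cast map_castmx !castmx_comp /=.
by apply: eq_castmx.
Qed.

Let scale v : R := Num.sqrt ((deg v)%:R / (deg (Psi v : collapse Psi))%:R).

Definition pullback (f : cochain P') : cochain P :=
  cochain_of (fun v => (scale v)%:C *:
    castmx (esym (rankE v), erefl 1%N) (cochain_val f (Psi v : collapse Psi))).

Lemma pullback_val f v : cochain_val (pullback f) v = (scale v)%:C *:
  castmx (esym (rankE v), erefl 1%N) (cochain_val f (Psi v : collapse Psi)).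
Proof. exact: cochain_ofK. Qed.

Lemma pullback_is_linear : linear pullback.
Proof.
move=> a f g; rewrite -[LHS]cochain_valK -[RHS]cochain_valK.
apply/ffunP => -[w i]; rewrite [LHS]ffunE [RHS]ffunE /=.
congr (fun_of_matrix _ _ _).
rewrite cochain_valP !pullback_val cochain_valP.
apply/matrixP => k l; rewrite !(mxE, castmxE) /=.
by rewrite mulrDr mulrCA.
Qed.

HB.instance Definition _ := GRing.isLinear.Build R[i] (cochain P') (cochain P) _
  pullback pullback_is_linear.

Hypothesis deg_gt0 : forall v : X, (0 < deg v)%N.
Hypothesis Psi_surj : forall p : V', exists v : X, Psi v = p.

Let deg'_gt0 (p : V') : (0 < deg (p : collapse Psi))%N.
Proof.
have [v <-] := Psi_surj p; rewrite deg_collapse (bigD1 v) //=.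
by rewrite addn_gt0 deg_gt0.
Qed.

Let scale_sqr v : scale v ^+ 2 = (deg v)%:R / (deg (Psi v : collapse Psi))%:R.
Proof. by rewrite sqr_sqrtr // divr_ge0. Qed.

Lemma pullback_isometry f : fdot (pullback f) (pullback f) = fdot f f.
Proof.
rewrite !fdot_cochain (partition_big Psi xpredT) //=.
apply: eq_bigr => p _.
(* The term at [p] is spread over its fibre with weights [scale v ^+ 2], whose sum is 1 by
   [deg_collapse]. *)
have <- : \sum_(v | Psi v == p) (scale v ^+ 2)%:C *
    ((cochain_val f p)^t* *m cochain_val f p) 0 0 =
    ((cochain_val f p)^t* *m cochain_val f p) 0 0.
  rewrite -mulr_suml -rmorph_sum -[RHS]mul1r; congr (_ * _).
  rewrite -[RHS](rmorph1 (real_complex R)); congr (_%:C).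
  under eq_bigr => v /eqP vp do rewrite scale_sqr vp.
  rewrite -mulr_suml -natr_sum -deg_collapse divff //.
  by rewrite pnatr_eq0 -lt0n deg'_gt0.
apply: eq_bigr => v /eqP <-.
rewrite !pullback_val conjmx_scale_real -scalemxAl -scalemxAr scalerA.
rewrite mxE -rmorphM /= -expr2; congr (_ * _ 0 0).
(* An identity matrix is inserted to play the role of [M] in [cast_form]. *)
rewrite -[X in X *m _]mulmx1 cast_form; congr (_ *m _).
by rewrite -[RHS]mulmx1; congr (_ *m _); case: _ / (rankE v).
Qed.

(** The numerators of the two scales cancel the degrees in [X], and their denominators supply those
    in the collapse. Positive degrees make all four roots invertible. *)
Lemma edge_weight_collapse (e : edge X) :
  edge_weight e * scale (ter e) * scale (ini e) =
  edge_weight (e : edge (collapse Psi)).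
Proof.
have s0 n : (0 < n)%N -> Num.sqrt n%:R != 0 :> R.
  by move=> n0; rewrite sqrtr_eq0 -ltNge ltr0n.
rewrite /edge_weight /scale !natrM !sqrtrM ?ler0n // !sqrtrV ?ler0n //.
have ht := s0 _ (deg_gt0 (ter e)); have hi := s0 _ (deg_gt0 (ini e)).
have ht' := s0 _ (deg'_gt0 (Psi (ter e))).
have hi' := s0 _ (deg'_gt0 (Psi (ini e))).
by field; rewrite ht hi ht' hi'.
Qed.

Lemma pullback_form f :
  fdot (Delta P (pullback f)) (pullback f) = fdot (Delta P' f) f.
Proof.
rewrite !DeltaE !laplacian_form pullback_isometry; congr (_ - _).
apply: eq_bigr => e _; rewrite !pullback_val -edge_weight_collapse.
rewrite conjmx_scale_real -!scalemxAl -scalemxAr scalerA mxE cast_form.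
by rewrite mulrA -!rmorphM /= mulrA.
Qed.

End CollapseForm.

Theorem theorem8 (R : realType) (X : graph) (P : transmission R X)
    (V' : finType) (Psi : X -> V')
    (deg_gt0 : forall v : X, (0 < deg v)%N)
    (symP : tsymmetric P)
    (Psi_surj : forall p : V', exists v : X, Psi v = p)
    (rank_fibre : forall v w : X, Psi v = Psi w -> rank P v = rank P w) :
  let P' := collapse_transmission rank_fibre in
  tsymmetric P' /\
  (exists lambda : seq R, is_spectrum (Delta P) lambda) /\
  (exists mu : seq R, is_spectrum (Delta P') mu) /\
  forall lambda mu : seq R,
    is_spectrum (Delta P) lambda -> is_spectrum (Delta P') mu ->
    forall j : nat, (j < size mu)%N ->
      (j < size lambda)%N /\ lambda`_j <= mu`_j.
Proof.
move=> P'; have symP' : tsymmetric P' := collapse_tsymmetric rank_fibre symP.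
have sa := Delta_self_adjoint symP; have sa' := Delta_self_adjoint symP'.
split=> //; split; first exact: exists_spectrum.
split; first exact: exists_spectrum.
move=> lambda mu.
apply: (interlacing (J := @pullback R X P V' Psi rank_fibre) sa sa').
  exact: pullback_isometry.
exact: pullback_form.
Qed.
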